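(* Let $A$ and $B$ be unital $C^*$-algebras, and assume that $A$ has real rank zero. Let $T:A\to B$ be a bounded linear map such that, for all $a,b\in A^\wedge$, $a\leq_\diamond b$ implies $T(a)\leq_\diamond T(b)$. Then the following assertions hold. (1) If $T(\mathbf{1})$ is a projection of $B$, then $T$ is a Jordan $^*$-homomorphism. (2) If $T(A)\cap B^{-1}\neq\emptyset$ and $T(\mathbf{1})$ is a partial isometry, then $T$ is a Jordan $^*$-homomorphism multiplied by a unitary element; that is, there are a unitary element $u\in B$ and a Jordan $^*$-homomorphism $S:A\to B$ such that $T(x)=uS(x)$ for all $x\in A$.
   Context: All algebras are complex; $\mathbf{1}$ denotes the identity element, and $B^{-1}$ the set of invertible elements of $B$. For elements $a,b$ of a unital $C^*$-algebra $A$, the diamond relation is defined by: $a\leq_\diamond b$ if and only if $aA\subseteq bA$, $Aa\subseteq Ab$ and $aa^*a=ab^*a$. $A^\wedge$ is the set of (von Neumann) regular elements of $A$, i.e. those $a\in A$ for which there is $c\in A$ with $a=aca$. A projection is a selfadjoint idempotent. A $C^*$-algebra has real rank zero if the set of all real linear combinations of mutually orthogonal projections is dense in the set of all hermitian elements. A linear map $S$ between $C^*$-algebras is a Jordan $^*$-homomorphism if $S(a^2)=S(a)^2$ and $S(a^* )=S(a)^*$ for all $a$. *)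

(* Defs.v *)
From HB Require Import structures.
From mathcomp Require Import all_boot all_order all_algebra.
From mathcomp Require Import complex.
From mathcomp Require Import boolp classical_sets reals topology normedtype.

Set Implicit Arguments.
Unset Strict Implicit.
Unset Printing Implicit Defensive.

Import Order.TTheory GRing.Theory Num.Theory.
Import numFieldNormedType.Exports.

Local Open Scope classical_set_scope.
Local Open Scope ring_scope.
Local Open Scope complex_scope.

(* Complex unital C*-algebras, the zero algebra included. The ring operations
   are fields of the mixin, and the ring structure is derived from them below,
   because Hierarchy Builder refuses a structure that inherits from both
   PzRing and NormedModule (they have no join below Num.NumDomain). *)
HB.mixin Record isUnitalCStarAlgebra (R : realType) A
    of CompleteNormedModule R[i] A := {
  cstar_one : A ;
  cstar_mul : A -> A -> A ;
  star : A -> A ;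
  cstar_mulA : associative cstar_mul ;
  cstar_mul1l : left_id cstar_one cstar_mul ;
  cstar_mul1r : right_id cstar_one cstar_mul ;
  cstar_mulDl : left_distributive cstar_mul +%R ;
  cstar_mulDr : right_distributive cstar_mul +%R ;
  cstar_scaleAl : forall (k : R[i]) (x y : A),
    k *: cstar_mul x y = cstar_mul (k *: x) y ;
  cstar_scaleAr : forall (k : R[i]) (x y : A),
    k *: cstar_mul x y = cstar_mul x (k *: y) ;
  cstar_normM : forall x y : A, `|cstar_mul x y| <= `|x| * `|y| ;
  starK : involutive star ;
  starD : {morph star : x y / x + y} ;
  starZ : forall (k : R[i]) (x : A), star (k *: x) = Num.conj k *: star x ;
  starM : forall x y : A, star (cstar_mul x y) = cstar_mul (star y) (star x) ;
  cstar_identity : forall x : A, `|cstar_mul (star x) x| = `|x| ^+ 2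
}.

#[short(type="unitalCStarAlgType")]
HB.structure Definition UnitalCStarAlgebra (R : realType) :=
  {A of CompleteNormedModule R[i] A & isUnitalCStarAlgebra R A}.

HB.instance Definition _ (R : realType) (A : unitalCStarAlgType R) :=
  GRing.Zmodule_isPzRing.Build (UnitalCStarAlgebra.sort A)
    (@cstar_mulA R A) (@cstar_mul1l R A) (@cstar_mul1r R A)
    (@cstar_mulDl R A) (@cstar_mulDr R A).

Definition hermitian (R : realType) (A : unitalCStarAlgType R) : set A :=
  [set a | star a = a].

Definition projection (R : realType) (A : unitalCStarAlgType R) : set A :=
  [set p | star p = p /\ p * p = p].

Definition partial_isometry (R : realType) (A : unitalCStarAlgType R) : set A :=
  [set v | v * star v * v = v].

Definition unitary (R : realType) (A : unitalCStarAlgType R) : set A :=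
  [set u | star u * u = 1 /\ u * star u = 1].

Definition invertible (R : realType) (A : unitalCStarAlgType R) : set A :=
  [set b | exists c, c * b = 1 /\ b * c = 1].

(* von Neumann regular elements *)
Definition regular (R : realType) (A : unitalCStarAlgType R) : set A :=
  [set a | exists c, a = a * c * a].

Definition diamond_le (R : realType) (A : unitalCStarAlgType R) (a b : A) :=
  [/\ [set a * x | x in [set: A]] `<=` [set b * x | x in [set: A]],
      [set x * a | x in [set: A]] `<=` [set x * b | x in [set: A]]
    & a * star a * a = a * star b * a].

Definition orthogonal_projections_span (R : realType)
    (A : unitalCStarAlgType R) : set A :=
  [set x | exists (n : nat) (t : 'I_n -> R) (p : 'I_n -> A),
    [/\ forall i, projection (p i),
        forall i j, i != j -> p i * p j = 0
      & x = \sum_(i < n) (t i)%:C *: p i]].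

(* The span consists of hermitian elements, so this inclusion is density in the
   set of hermitian elements. *)
Definition real_rank_zero (R : realType) (A : unitalCStarAlgType R) :=
  @hermitian R A `<=` closure (@orthogonal_projections_span R A).

Definition bounded_map (R : realType) (A B : unitalCStarAlgType R)
    (T : A -> B) :=
  exists M : R, forall x, `|T x| <= M%:C * `|x|.

Definition jordan_star_hom (R : realType) (A B : unitalCStarAlgType R)
    (S : {linear A -> B}) :=
  forall a : A, S (a ^+ 2) = S a ^+ 2 /\ S (star a) = star (S a).

(* Main.v *)
From HB Require Import structures.
Require Import Defs.
From mathcomp Require Import all_boot all_order all_algebra.
From mathcomp Require Import complex.
From mathcomp Require Import boolp classical_sets reals topology normedtype.

Import Order.TTheory GRing.Theory Num.Theory.
Import numFieldNormedType.Exports.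

Local Open Scope classical_set_scope.
Local Open Scope ring_scope.

(** For a projection p, [p <=_diamond 1] holds, so a = T p lies in e B e, where
    e = T 1 is a projection, and a (star a) a = a^2; the same applies to
    e - a = T (1 - p).  Eliminating e leaves relations between a and star a
    which force (a - star a)^3 = 0, so a is hermitian by the C*-identity, and
    then a = a^2.  Thus T preserves projections, hence their orthogonality, and
    is Jordan on real combinations of orthogonal projections; real rank zero and
    boundedness extend this to hermitian elements, and then to A.  In (2), with
    v = T 1, the range of T is contained in the closed subspace of the x such
    that v (star v) x = x = x (star v) v, so an invertible value makes v
    unitary, and (1) applies to (star v) T. *)

Lemma subrACA (V : zmodType) (x y z t : V) :
  (x - y) - (z - t) = (x - z) - (y - t).
Proof. by rewrite !opprD !opprK addrACA. Qed.

(** * Norm, star, projections and density in a unital C*-algebra *)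

Section CStarAlgebra.
Context {R : realType} {A : unitalCStarAlgType R}.
Implicit Types (x y z a b u p q : A).

Lemma star_mul x y : star (x * y) = star y * star x.
Proof. exact: starM. Qed.

Lemma scale_mull (k : R[i]) x y : k *: (x * y) = (k *: x) * y.
Proof. exact: cstar_scaleAl. Qed.

Lemma scale_mulr (k : R[i]) x y : k *: (x * y) = x * (k *: y).
Proof. exact: cstar_scaleAr. Qed.

Lemma norm_mul_le x y : `|x * y| <= `|x| * `|y|.
Proof. exact: cstar_normM. Qed.

Lemma norm_mul3_le x y z : `|x * y * z| <= `|x| * `|y| * `|z|.
Proof. by rewrite (le_trans (norm_mul_le _ _))// ler_wpM2r// norm_mul_le. Qed.

Lemma norm_star_mul x : `|star x * x| = `|x| ^+ 2.
Proof. exact: cstar_identity. Qed.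

Lemma star0 : star (0 : A) = 0.
Proof. by apply: (addrI (star (0 : A))); rewrite -starD !addr0. Qed.

Lemma starN x : star (- x) = - star x.
Proof. by apply: (addrI (star x)); rewrite -starD !subrr star0. Qed.

Lemma starB x y : star (x - y) = star x - star y.
Proof. by rewrite starD starN. Qed.

Lemma star1 : star (1 : A) = 1.
Proof. by rewrite -[LHS]mul1r -[X in X * _]starK -star_mul mul1r starK. Qed.

Lemma star_sum n (F : 'I_n -> A) : star (\sum_i F i) = \sum_i star (F i).
Proof. exact: (big_morph _ (@starD _ _) star0). Qed.

Lemma norm_le_star x : `|x| <= `|star x|.
Proof.
have [->|x0] := eqVneq x 0; first by rewrite normr0.
rewrite -(ler_pM2r (x := `|x|)) ?normr_gt0//.
by rewrite -expr2 -norm_star_mul norm_mul_le.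
Qed.

Lemma norm_star x : `|star x| = `|x|.
Proof.
by apply/eqP; rewrite eq_le norm_le_star -{2}[x]starK norm_le_star.
Qed.

Lemma star_mul_eq0 x : star x * x = 0 -> x = 0.
Proof.
move=> xx0; apply/eqP; rewrite -normr_eq0 -sqrf_eq0.
by rewrite -norm_star_mul xx0 normr0.
Qed.

Lemma mulr2_eq0 x : x + x = 0 -> x = 0.
Proof.
rewrite -mulr2n -scaler_nat => /eqP; rewrite scaler_eq0 pnatr_eq0 /=.
exact: eqP.
Qed.

(** For skew [x], [star x * x = - (x * x)] is hermitian with square [x^4 = 0]; the C*-identity, used
    twice, then gives [x = 0]. *)
Lemma skew_cube_eq0 x : star x = - x -> x * x * x = 0 -> x = 0.
Proof.
move=> sx x3; apply: star_mul_eq0; apply: star_mul_eq0.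
by rewrite star_mul starK sx !mulNr mulrN opprK mulrA x3 mul0r.
Qed.

(** The hypotheses are what the diamond relation to a projection [e] says of [a] and of [e - a],
    after [e] is eliminated. *)
Lemma projection_of_diamond a :
  a * star a * a = a * a -> a * a + star a = star a * a + a * star a ->
  projection a.
Proof.
set s := star a => asa aa.
have ss : s * s + a = s * a + a * s.
  by have := congr1 star aa; rewrite !starD !star_mul /s !starK.
have w2 : (a - s) * (a - s) = a * a - a.
  have e : s * s - s * a = a * s - a.
    by apply/eqP; rewrite subr_eq addrAC eq_sym subr_eq ss addrC.
  by rewrite mulrBl !mulrBr opprB e addrA subrK.
(* Multiplying [aa] on the right by [a] gives [(a - s)(a^2 - a) = 0], which by [w2] is
   [(a - s)^3 = 0]. *)
have sa : s * (a * a - a) = a * (a * a - a).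
  have := congr1 ( *%R^~ a) aa; rewrite /= !mulrDl asa !mulrBr => e.
  by apply/eqP; rewrite subr_eq addrAC eq_sym subr_eq !mulrA e.
have as0 : a = s.
  apply/eqP; rewrite -subr_eq0; apply/eqP; apply: skew_cube_eq0.
    by rewrite starB /s starK opprB.
  by rewrite -mulrA w2 mulrBl sa subrr.
have aas : a * a + a = a * a + a * a by move: aa; rewrite -as0.
by split; [rewrite -/s -as0|exact/esym/(addrI _ aas)].
Qed.

Lemma projectionC p : projection p -> projection (1 - p).
Proof.
case=> sp pp; split; first by rewrite starB star1 sp.
by rewrite mulrBr mulr1 mulrBl mul1r pp subrr subr0.
Qed.

Lemma projectionD p q :
  projection p -> projection q -> p * q = 0 -> projection (p + q).
Proof.
move=> [sp pp] [sq qq] pq; split; first by rewrite starD sp sq.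
have qp : q * p = 0 by rewrite -[LHS]starK star_mul sp sq pq star0.
by rewrite mulrDl !mulrDr pp qq pq qp addr0 add0r.
Qed.

(** Idempotence of [p + q] makes [p] and [q] anticommute; multiplying that relation by [p] on either
    side shows that they also commute, so [2 p q = 0]. *)
Lemma projectionD_orthogonal p q :
  projection p -> projection q -> projection (p + q) -> p * q = 0.
Proof.
move=> [sp pp] [sq qq] [_]; rewrite mulrDl !mulrDr pp qq => e.
have pqN : p * q = - (q * p).
  apply/eqP; rewrite -addr_eq0; apply/eqP.
  by apply: (addrI p); apply: (addIr q); rewrite addr0 -[RHS]e !addrA.
have qpq : p * q = - (p * q * p).
  by rewrite -{1}pp -mulrA {1}pqN mulrN mulrA.
have : q * p = p * q.
  have : p * q * p = - (q * p) by rewrite pqN mulNr -mulrA pp.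
  by move=> e'; rewrite [RHS]qpq e' opprK.
by move=> qp; apply: mulr2_eq0; rewrite {1}pqN qp addNr.
Qed.

Lemma projection_regular p : projection p -> regular p.
Proof. by case=> _ pp; exists p; rewrite !pp. Qed.

Lemma one_projection : projection (1 : A).
Proof. by split; rewrite ?star1 ?mulr1. Qed.

Lemma projection_diamond_le1 p : projection p -> diamond_le p 1.
Proof.
case=> sp pp; split; last by rewrite sp star1 mulr1 !pp.
- by move=> _ [x _ <-]; exists (p * x) => //; rewrite mul1r.
- by move=> _ [x _ <-]; exists (x * p) => //; rewrite mulr1.
Qed.

Lemma diamond_le_mem a b : diamond_le a b ->
  [/\ exists x, a = b * x, exists x, a = x * b
    & a * star a * a = a * star b * a].
Proof.
case=> ab ba e; split => //.
- by have [|x _ <-] := ab a; [exists 1; rewrite ?mulr1|exists x].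
- by have [|x _ <-] := ba a; [exists 1; rewrite ?mul1r|exists x].
Qed.

(** The first inclusion is multiplied by [u] on the left; the other two conditions follow by
    cancelling [star u * u]. *)
Lemma diamond_le_mulunitary (u a b : A) :
  unitary u -> diamond_le a b -> diamond_le (u * a) (u * b).
Proof.
move=> [uu _] [ab ba e]; split.
- move=> _ [x _ <-]; have [|y _ h] := ab (a * x); first by exists x.
  by exists y => //; rewrite -!mulrA h.
- move=> _ [x _ <-]; have [|y _ h] := ba (x * u * a); first by exists (x * u).
  by exists (y * star u) => //; rewrite mulrA -(mulrA y) uu mulr1 h mulrA.
- rewrite !star_mul !mulrA -(mulrA (u * a * star a)) uu mulr1.
  by rewrite -(mulrA (u * a * star b)) uu mulr1 -!mulrA; congr (_ * _);
    rewrite !mulrA.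
Qed.

Lemma hermitian_decomposition x :
  exists h k : A, [/\ star h = h, star k = k & x = h + 'i *: k].
Proof.
have half : Num.conj (2^-1 : R[i]) = 2^-1 by rewrite conj_Creal ?realV ?realn.
exists (2^-1 *: (x + star x)), (('i / 2) *: (star x - x)); split.
- by rewrite starZ starD starK half addrC.
- rewrite starZ starB starK rmorphM /= half conjCi mulNr.
  by rewrite scaleNr -scalerN opprB.
- rewrite scalerA mulrA -expr2 sqrCi mulN1r scaleNr -scalerN opprB -scalerDr.
  rewrite addrACA subrr addr0 -mulr2n -[x *+ 2]scaler_nat scalerA.
  by rewrite mulVf ?pnatr_eq0// scale1r.
Qed.

Lemma sum_projections_sqr n (c : 'I_n -> R[i]) (p : 'I_n -> A) :
  (forall i, projection (p i)) -> (forall i j, i != j -> p i * p j = 0) ->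
  (\sum_i c i *: p i) * (\sum_i c i *: p i) = \sum_i (c i * c i) *: p i.
Proof.
move=> pp pq; rewrite mulr_suml; apply: eq_bigr => i _.
rewrite mulr_sumr (bigD1 i)//= big1 ?addr0 => [|j ji].
  by rewrite -scale_mull -scale_mulr scalerA (pp i).2.
by rewrite -scale_mull -scale_mulr pq 1?eq_sym// !scaler0.
Qed.

Lemma star_orthogonal_projections_span x :
  orthogonal_projections_span x -> star x = x.
Proof.
move=> [n [t [p [pp _ ->]]]]; rewrite star_sum.
apply: eq_bigr => i _; rewrite starZ (pp i).1 conj_Creal//.
by apply/Creal_ReP; rewrite -complexRe.
Qed.

Lemma norm_sqrB x y :
  `|x * x - (x - y) * (x - y)| <= (`|x| + `|x| + `|y|) * `|y|.
Proof.
have -> : x * x - (x - y) * (x - y) = x * y + y * (x - y).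
  by rewrite [(x - y) * _]mulrBl opprB addrCA -mulrBr subKr addrC.
rewrite (le_trans (ler_normD _ _))// -addrA mulrDl lerD ?norm_mul_le//.
rewrite (le_trans (norm_mul_le _ _))// mulrC ler_wpM2r//.
exact: ler_normB.
Qed.

(** A quantitative form of continuity at [h]. The estimate is asked for small [d] only, so that
    quadratic expressions in [x] qualify. *)
Lemma closure_eq0 (B : unitalCStarAlgType R) (S : set A) (f : A -> B)
    (h : A) (K : R[i]) :
  closure S h -> (forall x, S x -> f x = 0) -> 0 <= K ->
  (forall d, `|d| <= 1 -> `|f h - f (h - d)| <= K * `|d|) -> f h = 0.
Proof.
move=> Sh fS K0 fK; apply/eqP; rewrite -normr_le0; apply: contraT => fh.
have c0 : 0 < `|f h| by rewrite normr_gt0 -normr_le0.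
(* This radius satisfies both [e <= 1] and [K * e < c], so a point of [S] in the ball forces
   [c < c]. *)
set c := `|f h| in c0 *; pose e := c / (1 + K + c).
have D0 : 0 < 1 + K + c by rewrite addr_gt0// ltr_pwDl.
have e0 : 0 < e by rewrite divr_gt0.
have e1 : e <= 1 by rewrite ler_pdivrMr// mul1r lerDr addr_ge0.
have [x [Sx]] := Sh _ (nbhsx_ballx h e e0).
rewrite -ball_normE /= => xe.
have := fK (h - x) (le_trans (ltW xe) e1).
rewrite subKr (fS x Sx) subr0 -/c => cK.
have : c < c.
  rewrite (le_lt_trans cK)// (le_lt_trans (ler_wpM2l K0 (ltW xe)))//.
  rewrite mulrA ltr_pdivrMr// mulrC ltr_pM2l// -addrA addrCA ltrDl.
  by rewrite addr_gt0.
by rewrite ltxx.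
Qed.

End CStarAlgebra.

Section LeftMultiplication.
Context {R : realType} {B : unitalCStarAlgType R}.

(** Named so that it carries a linear structure, which its composite with [T] inherits. *)
Definition left_mult (u x : B) : B := u * x.

Lemma left_mult_is_linear u : linear (left_mult u).
Proof. by move=> k x y; rewrite /left_mult mulrDr scale_mulr. Qed.

HB.instance Definition _ u :=
  GRing.isLinear.Build R[i] B B _ (left_mult u) (left_mult_is_linear u).

End LeftMultiplication.

(** Vanishing passes from projections to their span by linearity, to hermitian elements by density,
    and to [A] by real and imaginary parts. *)
Lemma bounded_linear_eq0 {R : realType} {A B : unitalCStarAlgType R}
    (g : A -> B) (K : R[i]) :
  real_rank_zero A -> linear g -> (forall p, projection p -> g p = 0) ->
  0 <= K -> (forall x, `|g x| <= K * `|x|) -> forall x, g x = 0.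
Proof.
move=> rrA lg gp K0 gK.
pose G : {linear A -> B} := HB.pack g (GRing.isLinear.Build _ _ _ _ g lg).
suff hG h : star h = h -> g h = 0.
  move=> x; have [h [k [sh sk ->]]] := hermitian_decomposition x.
  by rewrite -[g _]/(G _) linearD linearZ/= !hG// scaler0 addr0.
move=> sh; have Sh : closure (@orthogonal_projections_span R A) h := rrA h sh.
apply: (closure_eq0 _ _ g h K Sh) => // [x [n [t [p [pp _ ->]]]]|d _].
  by rewrite -[g _]/(G _) linear_sum big1// => i _;
    rewrite linearZ/= [g _]gp// scaler0.
by rewrite -![g _]/(G _) linearB subKr; exact: gK.
Qed.

Section DiamondPreserver.
Context {R : realType} {A B : unitalCStarAlgType R}.
Context {T : {linear A -> B}} {K : R[i]}.
Hypothesis rrA : real_rank_zero A.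
Hypothesis K0 : 0 <= K.
Hypothesis bT : forall x, `|T x| <= K * `|x|.
Hypothesis dT : forall p, projection p -> diamond_le (T p) (T 1).

(** * The case where [T 1] is a projection *)

Section ProjectionUnit.
Hypothesis T1 : projection (T 1).

Lemma projection_image p : projection p -> projection (T p).
Proof.
have mem q : projection q ->
    [/\ T 1 * T q = T q, T q * T 1 = T q & T q * star (T q) * T q = T q * T q].
  move=> pq; have [[x ax] [y ay] e] := diamond_le_mem _ _ (dT q pq).
  have eq : T 1 * T q = T q by rewrite ax mulrA T1.2.
  have qe : T q * T 1 = T q by rewrite ay -mulrA T1.2.
  by split=> //; rewrite e T1.1 qe.
move=> pp; have [ea ae aa] := mem p pp.
have [] := mem _ (projectionC _ pp).
have es : T 1 * star (T p) = star (T p) by rewrite -{1}T1.1 -star_mul ae.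
have se : star (T p) * T 1 = star (T p) by rewrite -{1}T1.1 -star_mul ea.
have [sT _] := T1; rewrite linearB; set e := T 1 in sT ea ae es se *.
set a := T p in ea ae aa es se *; set s := star a in aa es se *.
move=> eb be bb; apply: projection_of_diamond => //.
(* Writing [s] as [e - star (e - a)] brings in [bb]; expanding the product then gives the second
   hypothesis of [projection_of_diamond]. *)
have : (e - a) * s * (e - a) = 0.
  have -> : s = e - star (e - a) by rewrite starB sT subKr.
  by rewrite [_ * (e - star _)]mulrBr mulrBl be bb subrr.
rewrite [(e - a) * s]mulrBl es mulrBr !mulrBl -mulrA se aa => /eqP.
by rewrite subr_eq0 subr_eq addrAC eq_sym subr_eq => /eqP ->; rewrite addrC.
Qed.

Lemma orthogonal_image p q :
  projection p -> projection q -> p * q = 0 -> T p * T q = 0.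
Proof.
move=> pp qq pq; apply: projectionD_orthogonal; try exact: projection_image.
by rewrite -linearD; apply/projection_image/projectionD.
Qed.

Lemma span_star x : orthogonal_projections_span x -> star (T x) = T x.
Proof.
move=> [n [t [p [pp pq ->]]]]; rewrite linear_sum.
apply: star_orthogonal_projections_span.
exists n, t, (T \o p); split=> [i|i j ij|] /=.
- exact: projection_image.
- by apply: orthogonal_image => //; exact: pq.
- by apply: eq_bigr => i _; rewrite linearZ.
Qed.

(** The [T (p i)] are again orthogonal projections, so both sides equal the sum of the
    [(t i)^2 *: T (p i)]. *)
Lemma span_sqr x : orthogonal_projections_span x -> T (x * x) = T x * T x.
Proof.
move=> [n [t [p [pp pq ->]]]].
rewrite sum_projections_sqr// !linear_sum/=.
under eq_bigr do rewrite linearZ/=.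
under [X in _ = X * _]eq_bigr do rewrite linearZ/=.
under [X in _ = _ * X]eq_bigr do rewrite linearZ/=.
rewrite sum_projections_sqr// => [i|i j ij]; first exact: projection_image.
by apply: orthogonal_image => //; exact: pq.
Qed.

Lemma hermitian_star h : star h = h -> star (T h) = T h.
Proof.
move=> sh; apply/eqP; rewrite -subr_eq0; apply/eqP.
have Sh : closure (@orthogonal_projections_span R A) h := rrA h sh.
apply: (closure_eq0 _ _ (fun x => star (T x) - T x) h (K + K) Sh).
- by move=> x /span_star ->; rewrite subrr.
- exact: addr_ge0.
move=> d _ /=; rewrite [T (h - d)]linearB starB [X in _ - X]subrACA subKr.
by rewrite (le_trans (ler_normB _ _))// norm_star mulrDl lerD.
Qed.

Lemma hermitian_sqr h : star h = h -> T (h * h) = T h * T h.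
Proof.
move=> sh; apply/eqP; rewrite -subr_eq0; apply/eqP.
have Sh : closure (@orthogonal_projections_span R A) h := rrA h sh.
(* From [norm_sqrB] at [h] and at [T h]: [|d| <= 1] gives the [1] in [c], and [|T d| <= K] gives the
   inner [K] in [c']. *)
pose c := `|h| + `|h| + 1; pose c' := (`|T h| + `|T h| + K) * K.
have c0 : 0 <= c by rewrite !addr_ge0.
have c'0 : 0 <= c' by rewrite mulr_ge0// !addr_ge0.
apply: (closure_eq0 _ _ (fun x => T (x * x) - T x * T x) h (K * c + c') Sh).
- by move=> x /span_sqr ->; rewrite subrr.
- by rewrite addr_ge0// mulr_ge0.
move=> d d1 /=; rewrite subrACA -linearB [T (h - d)]linearB.
rewrite (le_trans (ler_normB _ _))//.
rewrite [leRHS]mulrDl lerD//.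
  rewrite (le_trans (bT _))// -mulrA ler_wpM2l//.
  by rewrite (le_trans (norm_sqrB _ _))// ler_wpM2r// lerD2l.
rewrite (le_trans (norm_sqrB _ _))// -mulrA ler_pM// ?addr_ge0//.
by rewrite lerD2l (le_trans (bT _))// -[leRHS]mulr1 ler_wpM2l.
Qed.

Lemma jordan_star_hom_of_diamond : jordan_star_hom T.
Proof.
move=> a; have [h [k [sh sk ->]]] := hermitian_decomposition a.
split.
  have shk : star (h + k) = h + k by rewrite starD sh sk.
  (* Polarisation: expand the square of [h + k] and cancel the pure squares. This handles the cross
     term of [(h + i k)^2]. *)
  have hk : T (h * k + k * h) = T h * T k + T k * T h.
    have := hermitian_sqr _ shk.
    rewrite !mulrDl !mulrDr !linearD/= !mulrDl !mulrDr !hermitian_sqr//.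
    by rewrite -!addrA => /addrI; rewrite !addrA => /addIr.
  rewrite !expr2 [in RHS]linearD [in RHS]linearZ/= !mulrDl !mulrDr.
  rewrite -!scale_mull -!scale_mulr !linearD !linearZ/= !hermitian_sqr//.
  rewrite -!addrA; congr (_ + _); rewrite !addrA; congr (_ + _).
  by rewrite -!scalerDr -linearD hk.
rewrite starD starZ sh sk linearD linearZ/= linearD linearZ/= starD starZ.
by rewrite !hermitian_star.
Qed.

End ProjectionUnit.

(** * The case where [T 1] is a partial isometry *)

Section PartialIsometryUnit.
Hypothesis T1 : partial_isometry (T 1).

(** For a projection [p], [T p] lies in [v B] and in [B v], where [v = T 1]; since
    [v * star v * v = v], both identities hold at [p], and [bounded_linear_eq0] extends them. *)
Lemma range_support x :
  T 1 * star (T 1) * T x = T x /\ T x * star (T 1) * T 1 = T x.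
Proof.
set v := T 1; have Tp p : projection p ->
    v * star v * T p = T p /\ T p * star v * v = T p.
  move=> pp; have [[y ay] [z az] _] := diamond_le_mem _ _ (dT p pp).
  split; first by rewrite ay mulrA T1.
  by rewrite az -!mulrA (mulrA _ _ (T 1)) T1.
have n0 : 0 <= `|v| * `|star v| * K + K by rewrite addr_ge0// !mulr_ge0.
split; apply/eqP; rewrite -subr_eq0; apply/eqP.
- apply: (bounded_linear_eq0 (fun x => v * star v * T x - T x) _ rrA _ _ n0).
  + move=> k y z; rewrite linearD linearZ/= mulrDr -scale_mulr.
    by rewrite opprD addrACA -scalerBr.
  + by move=> p /Tp[-> _]; rewrite subrr.
  + move=> y; rewrite (le_trans (ler_normB _ _))// mulrDl lerD//.
    rewrite (le_trans (norm_mul3_le _ _ _))// -[leRHS]mulrA.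
    by rewrite ler_wpM2l// mulr_ge0.
- apply: (bounded_linear_eq0 (fun x => T x * star v * v - T x) _ rrA _ _ n0).
  + move=> k y z; rewrite linearD linearZ/= !mulrDl -!scale_mull.
    by rewrite opprD addrACA -scalerBr.
  + by move=> p /Tp[_ ->]; rewrite subrr.
  + move=> y; rewrite (le_trans (ler_normB _ _))// mulrDl lerD//.
    rewrite (le_trans (norm_mul3_le _ _ _))// -[leRHS]mulrA.
    rewrite [leLHS]mulrC [X in _ * X <= _]mulrC [leLHS]mulrA.
    by rewrite ler_wpM2l// mulr_ge0.
Qed.

(** An invertible [T x] cancels from the two identities of [range_support]. *)
Lemma unit_unitary : range T `&` @invertible R B !=set0 -> unitary (T 1).
Proof.
move=> [_ [[x _ <-] [c [cT Tc]]]]; have [l r] := range_support x.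
split.
  by rewrite -[LHS]mul1r -cT -mulrA [X in _ * X]mulrA r.
by rewrite -[LHS]mulr1 -Tc [LHS]mulrA l.
Qed.

End PartialIsometryUnit.
End DiamondPreserver.

Theorem theorem3p5 (R : realType) (A B : unitalCStarAlgType R)
    (rrA : real_rank_zero A) (T : {linear A -> B}) (bT : bounded_map T)
    (dT : forall a b : A, regular a -> regular b ->
       diamond_le a b -> diamond_le (T a) (T b)) :
  (projection (T 1) -> jordan_star_hom T) /\
  (range T `&` @invertible R B !=set0 -> partial_isometry (T 1) ->
   exists (u : B) (S : {linear A -> B}),
     [/\ unitary u, jordan_star_hom S & forall x : A, T x = u * S x]).
Proof.
have {dT} dT p : projection p -> diamond_le (T p) (T 1).
  move=> pp; apply: dT; last exact: projection_diamond_le1.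
  - exact: projection_regular.
  - exact/projection_regular/one_projection.
have [K [K0 {}bT]] : exists K : R[i], 0 <= K /\ forall x, `|T x| <= K * `|x|.
  (* The given [M] may be negative; its modulus is also a bound. *)
  have [M TM] := bT; exists `|M%:C%C|; split=> // x.
  rewrite (le_trans (TM x))// ler_wpM2r// real_ler_norm//.
  by apply/Creal_ReP; rewrite -complexRe.
split=> [|inv T1]; first exact: (jordan_star_hom_of_diamond rrA K0 bT dT).
have [vv vv'] := unit_unitary rrA K0 bT dT T1 inv.
(* This [S] sends [1] to [star (T 1) * T 1 = 1], a projection, so the previous case applies to
   it. *)
exists (T 1), (left_mult (star (T 1)) \o T).
have uv : unitary (star (T 1)) by split; rewrite starK.
split=> [//||x]; last by rewrite /= /left_mult mulrA vv' mul1r.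
apply: (@jordan_star_hom_of_diamond _ _ _ _ (`|star (T 1)| * K)) => //.
- exact: mulr_ge0.
- move=> x; rewrite (le_trans (norm_mul_le _ _))// -mulrA.
  exact: ler_wpM2l.
- by move=> p pp; apply: diamond_le_mulunitary => //; exact: dT.
- by rewrite /= /left_mult vv; exact: one_projection.
Qed.
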